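(* Let $q\geq 2$ and $n\geq 1$ be integers, and let $p=1-\frac1q$. Then the burning number of the Hamming graph $H(n,q)$ satisfies \[ \beta(H(n,q))>pn-\sqrt{2pn\log n}. \]
   Context: Here $\log$ denotes the natural logarithm. Let $[q]:=\{0,1,\ldots,q-1\}$. The Hamming graph $H(n,q)$ has vertex set $[q]^n$, and two vertices are adjacent if and only if they differ in exactly one coordinate. For a finite graph $G$ with vertex set $V$ and graph distance $d$, and a vertex $x$ and non-negative integer $k$, let $\Gamma_k(x)=\{y\in V: d(x,y)\leq k\}$. A sequence $x_0,x_1,\ldots,x_b\in V$ is a burning sequence of length $b+1$ if $\bigcup_{k=0}^{b}\Gamma_{b-k}(x_k)=V$. The burning number $\beta(G)$ is the minimum length of a burning sequence of $G$. *)

(* Defs.v *)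
From HB Require Import structures.
From mathcomp Require Import all_boot all_order all_algebra.
From mathcomp Require Import boolp reals exp.
Set Implicit Arguments.
Unset Strict Implicit.
Unset Printing Implicit Defensive.

(* [None] when no natural number satisfies [P]. *)
Definition min_nat (P : pred nat) : option nat :=
  if pselect (exists m, P m) is left exP then Some (ex_minn exP) else None.

Section Burning.
Variables (T : finType) (e : rel T).

Definition has_walk (x y : T) (m : nat) : bool :=
  [exists w : m.-tuple T, path e x w && (last x w == y)].

(* [None] stands for infinite distance (distinct connected components). *)
Definition gdist (x y : T) : option nat := min_nat (has_walk x y).

Definition gball (k : nat) (x : T) : {set T} :=
  [set y | if gdist x y is Some d then d <= k else false].

Definition burning_seq (b : nat) (x : b.+1.-tuple T) : bool :=
  \bigcup_(k < b.+1) gball (b - k) (tnth x k) == [set: T].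

Definition has_burning_seq (m : nat) : bool :=
  if m is b.+1 then [exists x : b.+1.-tuple T, burning_seq x] else false.

(* The default 0 is reached only on the empty graph: see [min_burningP]. *)
Definition burning_number : nat := odflt 0 (min_nat has_burning_seq).

Lemma gball_refl k x : x \in gball k x.
Proof.
have w0 : has_walk x x 0 by apply/existsP; exists [tuple]; rewrite /= eqxx.
rewrite inE /gdist /min_nat; case: pselect => [h|[]]; last by exists 0.
by case: ex_minnP => m _ /(_ 0 w0); rewrite leqn0 => /eqP ->.
Qed.

Lemma min_burningP : 0 < #|T| ->
  has_burning_seq burning_number /\
  forall m, has_burning_seq m -> burning_number <= m.
Proof.
move=> T0.
have ex : exists m, has_burning_seq m.
  exists #|T|; rewrite -[#|T|](prednK T0) /=.
  have sz : size (enum T) == #|T|.-1.+1 by rewrite prednK // -cardE.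
  apply/existsP; exists (Tuple sz); apply/eqP/setP => y; rewrite in_setT.
  have /tnthP[k yk] : y \in Tuple sz by rewrite /= mem_enum.
  by apply/bigcupP; exists k => //; rewrite {1}yk gball_refl.
rewrite /burning_number /min_nat; case: pselect => //= h.
by case: ex_minnP.
Qed.

End Burning.

Definition hamming_adj (n q : nat) : rel {ffun 'I_n -> 'I_q} :=
  fun x y => #|[set i | x i != y i]| == 1.

Lemma hamming_adj_sym n q : symmetric (@hamming_adj n q).
Proof.
by move=> x y; congr (#|pred_of_set _| == 1); apply/setP => i; rewrite !inE eq_sym.
Qed.

Lemma hamming_adj_irr n q : irreflexive (@hamming_adj n q).
Proof.
move=> x; rewrite /hamming_adj (_ : [set i | _] = set0) ?cards0 //.
by apply/setP => i; rewrite !inE eqxx.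
Qed.

(* Main.v *)
Require Import Defs.
From HB Require Import structures.
From mathcomp Require Import all_boot all_order all_algebra.
From mathcomp Require Import boolp reals exp.
From mathcomp Require Import sequences ring lra.
Import Order.TTheory GRing.Theory Num.Theory.
Local Open Scope ring_scope.

(** Every ball of a burning sequence of length [b.+1] is contained in a Hamming
    ball of radius [b], so [q ^ n <= b.+1 * #|ball b|]. The density of the ball
    is [P(X <= b)] for [X] binomial with parameters [n] and [p], and Chernoff's
    lower tail bound gives [P(X <= p n - t) <= exp (- t ^ 2 / (2 p n))]. For
    [t = sqrt (2 p n log n)] the right-hand side is [1 / n], so a burning number
    at most [p n - t] would yield [1 <= (p n - t) / n <= p < 1]. *)

Definition hdist {n q : nat} (x y : {ffun 'I_n -> 'I_q}) : nat :=
  #|[set i | x i != y i]|.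

Lemma hdist_triangle n q (x y z : {ffun 'I_n -> 'I_q}) :
  (hdist x z <= hdist x y + hdist y z)%N.
Proof.
apply: leq_trans (leq_card_setU _ _); apply/subset_leq_card/subsetP => i.
by rewrite !inE -negb_and; apply: contraNN => /andP[/eqP -> /eqP ->].
Qed.

Lemma hdist_path n q (x : {ffun 'I_n -> 'I_q}) w :
  path (@hamming_adj n q) x w -> (hdist x (last x w) <= size w)%N.
Proof.
elim: w x => [|y w IHw] x /=.
  rewrite /hdist (_ : [set i | _] = set0) ?cards0 //.
  by apply/setP => i; rewrite !inE eqxx.
case/andP=> /eqP xy /IHw yw.
by apply: leq_trans (hdist_triangle n q x y _) _; rewrite /hdist xy add1n ltnS.
Qed.

(** Each edge of a walk changes one coordinate, so a walk of length [m] changes at most [m]. This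
    inclusion suffices, since balls are only bounded from above. *)
Lemma hdist_gball n q k (x y : {ffun 'I_n -> 'I_q}) :
  y \in gball (@hamming_adj n q) k x -> (hdist x y <= k)%N.
Proof.
rewrite inE /gdist /min_nat; case: pselect => // exm.
case: ex_minnP => m /existsP[w /andP[pw /eqP <-]] _.
by apply: leq_trans; rewrite -{2}(size_tuple w) hdist_path.
Qed.

(** The weight factors over the coordinates: at each one, the symbol of [x] contributes 1 and each
    of the other [q.-1] symbols contributes [z]. *)
Lemma sum_hdist (R : comNzRingType) n q (x : {ffun 'I_n -> 'I_q}) (z : R) :
  \sum_y z ^+ hdist x y = (1 + q.-1%:R * z) ^+ n.
Proof.
transitivity (\prod_(i < n) \sum_(c < q) z ^+ (x i != c)).
  rewrite bigA_distr_bigA; apply: eq_bigr => y _.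
  rewrite -(big_morph _ (exprD z) (expr0 z)) /hdist -sum1_card big_mkcond /=.
  by congr (z ^+ _); apply: eq_bigr => i _; rewrite inE; case: eqP.
rewrite -[n in RHS]card_ord -prodr_const; apply: eq_bigr => i _.
rewrite (bigD1 (x i)) //= eqxx expr0 (eq_bigr (fun=> z)); last first.
  by move=> c; rewrite eq_sym => ->.
by rewrite sumr_const cardC1 card_ord mulr_natl.
Qed.

(** Markov's inequality in counting form: a point of the ball has weight [z ^+ hdist x y] at least
    [z ^+ b], and the points outside have nonnegative weight. *)
Lemma card_hball_le (R : realDomainType) n q b (x : {ffun 'I_n -> 'I_q}) (z : R) :
  0 <= z <= 1 ->
  #|[set y | (hdist x y <= b)%N]|%:R * z ^+ b <= (1 + q.-1%:R * z) ^+ n.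
Proof.
case/andP=> z0 z1.
rewrite -(sum_hdist R n q x) mulr_natl -sumr_const big_mkcond /=.
apply: ler_sum => y _; rewrite inE; case: ifP => [yb|_]; last exact: exprn_ge0.
exact: ler_wiXn2l.
Qed.

Lemma card_burning_le n q b (x : b.+1.-tuple {ffun 'I_n -> 'I_q}) :
  burning_seq (@hamming_adj n q) x ->
  (q ^ n <= \sum_(k < b.+1) #|[set y | (hdist (tnth x k) y <= b)%N]|)%N.
Proof.
move=> /eqP cov.
have -> : (q ^ n = #|[set: {ffun 'I_n -> 'I_q}]|)%N.
  by rewrite cardsT card_ffun !card_ord.
rewrite -cov.
elim/big_ind2: _ => [|A m B l Am Bl|k _]; first by rewrite cards0.
  by apply: leq_trans (leq_add Am Bl); rewrite leq_card_setU.
apply/subset_leq_card/subsetP => y /hdist_gball yk.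
by rewrite inE (leq_trans yk) ?leq_subr.
Qed.

(** For nonnegative [x] the partial sums of the exponential series increase to their limit; the
    left-hand side is the third one. *)
Lemma expR_ge_quadratic (R : realType) (x : R) :
  0 <= x -> 1 + x + x ^+ 2 / 2 <= expR x.
Proof.
move=> x0.
have -> : 1 + x + x ^+ 2 / 2 = series (exp_coeff x) 3.
  rewrite /series /= /exp_coeff /= !big_nat_recr //= big_nil.
  by rewrite !factS fact0 !muln1 !divr1 add0r.
apply: nondecreasing_cvgn_le; last exact: is_cvg_series_exp_coeff.
by apply: nondecreasing_series => i _ _; exact: exp_coeff_ge0.
Qed.

Lemma expRN_le_quadratic (R : realType) (x : R) :
  0 <= x -> expR (- x) <= 1 - x + x ^+ 2 / 2.
Proof.
move=> x0.
rewrite expRN -div1r ler_pdivrMr ?expR_gt0 //.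
(* [(1 - x + x ^ 2 / 2) * (1 + x + x ^ 2 / 2) = 1 + x ^ 4 / 4] *)
have h := expR_ge_quadratic R x x0.
have d0 : 0 <= 1 - x + x ^+ 2 / 2 by nra.
apply: le_trans (ler_wpM2l d0 h).
have : 0 <= x ^+ 4 by apply: exprn_ge0.
lra.
Qed.

(** The covering bound combined with [card_hball_le] at [z = expR (- s)], divided by
    [q ^ n * z ^ b]; the parameter [s] is left free for optimisation. *)
Lemma burning_length_bound (R : realType) n q b (s : R) :
  (0 < q)%N -> 0 <= s -> has_burning_seq (@hamming_adj n q) b.+1 ->
  1 <= b.+1%:R * expR (s * b%:R + (1 - 1 / q%:R) * n%:R * (expR (- s) - 1)).
Proof.
move=> q0 s0 /existsP[x /card_burning_le hx]; set p : R := 1 - 1 / q%:R.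
have qR : 0 < q%:R :> R by rewrite ltr0n.
have s1 : 0 <= expR (- s) <= 1 by rewrite expR_ge0 expR_le1 oppr_le0.
have hb y := card_hball_le R n q b y _ s1.
have e0 : 0 < expR (- s) ^+ b by rewrite exprn_gt0 ?expR_gt0.
(* With [z = expR (- s)], the left-hand side equals [q * (1 + p * (z - 1))], and
   [1 + u <= expR u]. *)
have hz : 1 + q.-1%:R * expR (- s) <= q%:R * expR (p * (expR (- s) - 1)).
  apply: le_trans (ler_wpM2l (ltW qR) (expR_ge1Dx _)).
  rewrite -subn1 natrB // /p le_eqVlt; apply/orP; left; apply/eqP; field.
  by rewrite gt_eqF.
have hz' : (1 + q.-1%:R * expR (- s)) ^+ n <=
    q%:R ^+ n * expR (p * n%:R * (expR (- s) - 1)).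
  rewrite mulrAC expRM_natr -exprMn lerXn2r // nnegrE.
    by rewrite addr_ge0 // mulr_ge0 ?expR_ge0.
  by rewrite mulr_ge0 ?expR_ge0 // ltW.
have hyR : q%:R ^+ n * expR (- s) ^+ b <=
    b.+1%:R * (q%:R ^+ n * expR (p * n%:R * (expR (- s) - 1))).
  rewrite mulr_natl -[b.+1 in leRHS]card_ord -sumr_const.
  move: hx; rewrite -(ler_nat R) natrX natr_sum -(ler_pM2r e0) mulr_suml.
  by move/le_trans; apply; apply: ler_sum => k _; exact: le_trans (hb _) hz'.
have es : expR s = (expR (- s))^-1 by rewrite expRN invrK.
rewrite expRD mulrA mulrAC expRM_natr es exprVn.
rewrite ler_pdivlMr // mul1r -(@ler_pM2l _ (q%:R ^+ n)) ?exprn_gt0 //.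
by rewrite mulrCA.
Qed.

Theorem theorem3 (R : realType) (q n : nat) (hq : (2 <= q)%N) (hn : (1 <= n)%N) :
  let p : R := 1 - 1 / q%:R in
  (burning_number (@hamming_adj n q))%:R >
    p * n%:R - Num.sqrt (2 * p * n%:R * ln (n%:R : R)).
Proof.
set p : R := 1 - 1 / q%:R; rewrite /= ltNge; apply/negP => hle.
have q0 : (0 < q)%N by apply: ltn_trans hq.
have qR : 0 < q%:R :> R by rewrite ltr0n.
have nR : 0 < n%:R :> R by rewrite ltr0n.
have p_lt1 : p < 1 by rewrite ltrBlDr ltrDl divr_gt0.
have p_gt0 : 0 < p by rewrite subr_gt0 ltr_pdivrMr // mul1r ltr1n.
have pn_gt0 : 0 < p * n%:R by rewrite mulr_gt0.
have T0 : (0 < #|{ffun 'I_n -> 'I_q}|)%N.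
  by rewrite card_ffun !card_ord expn_gt0 q0.
have [+ _] := min_burningP (@hamming_adj n q) T0.
(* The case [B = 0] is absurd because [has_burning_seq] is false at 0. *)
set B := burning_number _ in hle *; case EB : B => [//|b] hb.
rewrite EB in hle.
have ln_ge : 0 <= ln (n%:R : R) by rewrite ln_ge0 // ler1n.
set t := Num.sqrt _ in hle.
have t0 : 0 <= t by apply: sqrtr_ge0.
have t2 : t ^+ 2 = 2 * p * n%:R * ln (n%:R : R).
  by rewrite sqr_sqrtr // mulr_ge0 // -mulrA mulr_ge0 // ltW.
(* This [s] minimises [- s * t + p * n * s ^ 2 / 2], the quadratic bound on the exponent; the
   minimum is [- t ^ 2 / (2 * p * n) = - ln n]. *)
pose s := t / (p * n%:R).
have s0 : 0 <= s by rewrite divr_ge0 // ltW.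
have ste : s * t - p * n%:R * (s ^+ 2 / 2) = ln (n%:R : R).
  have -> : s * t - p * n%:R * (s ^+ 2 / 2) = t ^+ 2 / (2 * (p * n%:R)).
    by rewrite /s; field; rewrite !gt_eqF.
  by rewrite t2; field; rewrite !gt_eqF.
have := burning_length_bound R n q b s q0 s0 hb; rewrite -/p /= leNgt => /negP; apply.
have he : s * b%:R + p * n%:R * (expR (- s) - 1) <= - ln (n%:R : R).
  have h1 : s * b%:R <= s * (p * n%:R - t).
    apply: ler_wpM2l => //; apply: le_trans hle.
    by rewrite ler_nat.
  have h2 : p * n%:R * (expR (- s) - 1) <= p * n%:R * (- s + s ^+ 2 / 2).
    apply: ler_wpM2l; first exact: ltW.
    by have := expRN_le_quadratic R s s0; lra.
  by rewrite -ste; lra.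
apply: (@le_lt_trans _ _ (b.+1%:R / n%:R)).
  apply: ler_wpM2l => //; rewrite -[n%:R^-1]lnK ?posrE ?invr_gt0 //.
  by rewrite ler_expR lnV.
(* The chain is [b.+1 <= p * n - t <= p * n < n]. Strictness comes from [p < 1], as [t] vanishes
   when [n = 1]. *)
rewrite ltr_pdivrMr // mul1r; apply: le_lt_trans hle _.
apply: (@le_lt_trans _ _ (p * n%:R)); first by rewrite lerBlDr lerDl.
by rewrite gtr_pMl.
Qed.
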